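(* Let $q$ be a prime power, $n$ a positive integer, and let $a,b,c\in\mathbb{F}_q$ with $a+b+c=0$ and $c\neq 0$. Let $A\subseteq\mathbb{F}_q^n$ be a subset such that every solution $(a_1,a_2,a_3)\in A^3$ of $a\,a_1+b\,a_2+c\,a_3=0$ satisfies $a_1=a_2=a_3$. Let $f(x)=\frac{1+x+x^2+\cdots+x^{q-1}}{x^{(q-1)/3}}$ and let $r$ be a real number with $0<r<1$ at which $f$ attains its minimum on the positive real axis. Then, as $n\to\infty$, \[ |A|\le \frac{3}{(1-r)r}\sqrt{\frac{f(r)}{f''(r)}}\,\frac{f(r)^n}{\sqrt{2\pi n}}\,(1+o(1)) . \] In particular $|A|=O\!\left(\frac{\theta_q^n}{\sqrt{n}}\right)$ where $\theta_q=f(r)$.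
   Context: Here $o(1)$ denotes a quantity (independent of $A$) tending to $0$ as $n\to\infty$ with $q$ fixed. *)

(* Defs.v *)
From HB Require Import structures.
From mathcomp Require Export all_boot all_order all_algebra.
From mathcomp Require Export all_classical all_reals all_analysis.
Export Order.TTheory GRing.Theory Num.Theory.
Export numFieldNormedType.Exports.

Set Implicit Arguments.
Unset Strict Implicit.
Unset Printing Implicit Defensive.

Local Open Scope ring_scope.

Definition prime_power (q : nat) : Prop :=
  exists p k : nat, [/\ prime p, (0 < k)%N & q = (p ^ k)%N].

(* The exponent (q - 1) / 3 is a real number, hence the real power powR;
   only the values at x > 0 are meaningful. *)
Definition fq (R : realType) (q : nat) (x : R) : R :=
  (\sum_(i < q) x ^+ i) / (x `^ ((q%:R - 1) / 3)).

Definition only_trivial_solutions (F : finFieldType) (n : nat) (a b c : F)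
    (A : {set 'rV[F]_n}) : Prop :=
  forall a1 a2 a3 : 'rV[F]_n, a1 \in A -> a2 \in A -> a3 \in A ->
    a *: a1 + b *: a2 + c *: a3 = 0 -> a1 = a2 /\ a2 = a3.

(* Main.v *)
Require Import Defs.
From mathcomp Require Import all_boot all_order all_algebra.
From mathcomp Require Import all_classical all_reals all_analysis.
From mathcomp Require Import finfield zify ring lra complex.

(* Put Q = q - 1. On A x A x A the function 1_{ax+by+cz=0}, which is the product
   over the coordinates of 1 - (ax_i+by_i+cz_i)^Q, is the diagonal tensor. Each
   of its monomials has degree at most Qn/3 in one of x, y, z, so its slice rank
   is at most 3N, where N counts the e in {0..Q}^n with sum at most Qn/3; the
   slice rank of a diagonal tensor is |A|, hence |A| <= 3N.

   To estimate N, give k in {0..Q} the weight r^k/g with g = 1+r+...+r^Q. Since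
   r is a critical point of f, this law has mean Q/3 and variance
   r^2 f''(r)/f(r). If S_n is the sum of n independent copies, then
   N = g^n * sum_{m <= Qn/3} r^(-m) P(S_n = m), and Fourier inversion bounds
   P(S_n = m) by (1/2pi) times the integral of |phi|^n, where phi is the
   characteristic function. Comparing |phi| with a Gaussian near 0 and with a
   constant < 1 elsewhere gives P(S_n = m) <= (1+o(1))/(sigma sqrt(2 pi n)),
   and the geometric sum contributes the factor 1/(1-r). *)

Set Implicit Arguments.
Unset Strict Implicit.
Unset Printing Implicit Defensive.
Local Open Scope ring_scope.

(** * Slice rank *)

(** Independent rows contain an invertible square block of columns, and solving on that block gives
    a vector equal to 1 there, hence of large support. *)
Lemma row_free_ones (F : fieldType) (d N : nat) (W : 'M[F]_(d, N)) :
  row_free W -> exists2 v : 'rV[F]_N, (v <= W)%MS &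
    exists2 g : 'I_d -> 'I_N, injective g & forall j, v 0 (g j) = 1.
Proof.
move=> W0.
have fW : row_full W^T by rewrite /row_full mxrank_tr.
pose g := fullrankfun fW.
have uW : colsub g W \in unitmx.
  by rewrite -unitmx_tr trmx_mxsub; apply: fullrowsub_unit.
exists (const_mx 1 *m invmx (colsub g W) *m W); first exact: submxMl.
exists g; first exact: fullrankfun_inj.
move=> j.
transitivity (colsub g (const_mx 1 *m invmx (colsub g W) *m W) (0 : 'I_1) j).
  by rewrite [RHS]mxE.
by rewrite -mulmx_colsub mulmxKV // mxE.
Qed.

Lemma mxrank_mxsub (F : fieldType) (m n m' n' : nat) (f : 'I_m' -> 'I_m)
  (g : 'I_n' -> 'I_n) (A : 'M[F]_(m, n)) : (\rank (mxsub f g A) <= \rank A)%N.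
Proof.
have -> : mxsub f g A = rowsub f (1%:M) *m A *m colsub g (1%:M).
  by rewrite -rowsubE mulmx_colsub mulmx1; apply/matrixP => i j; rewrite !mxE.
by apply: leq_trans (mxrankM_maxl _ _) _; apply: mxrankM_maxr.
Qed.

(** Contract the third variable with a vector [v] orthogonal to every [f m] and equal to 1 on at
    least N - k coordinates. The third group of slices vanishes and [diag_mx v] becomes a sum of two
    matrices of rank at most k, so N - k <= 2k. *)
Lemma slice_rank_diagonal (F : fieldType) (N k : nat) (f : 'I_k -> 'I_N -> F)
    (g1 g2 g3 : 'I_k -> 'I_N -> 'I_N -> F) :
  (forall x y z, ((x == y) && (y == z))%:R =
     \sum_m f m x * g1 m y z + \sum_m f m y * g2 m x z
     + \sum_m f m z * g3 m x y) ->
  (N <= 3 * k)%N.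
Proof.
move=> tensorE.
pose C : 'M[F]_(N, k) := \matrix_(z, m) f m z.
have [v vker [g g_inj vg]] := row_free_ones (row_base_free (kermx C)).
have vC : v *m C = 0 by apply/sub_kermxP; rewrite -(eq_row_base (kermx C)).
have vf m : \sum_z v 0 z * f m z = 0.
  transitivity ((v *m C) 0 m); last by rewrite vC mxE.
  by rewrite mxE; apply: eq_bigr => z _; rewrite mxE.
pose G1 : 'M[F]_(k, N) := \matrix_(m, y) \sum_z v 0 z * g1 m y z.
pose G2 : 'M[F]_(N, k) := \matrix_(x, m) \sum_z v 0 z * g2 m x z.
have diagE : diag_mx v = C *m G1 + G2 *m C^T.
  apply/matrixP => x y; rewrite !mxE.
  have -> : v 0 x *+ (x == y) = \sum_z v 0 z * ((x == y) && (y == z))%:R.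
    rewrite (bigD1 y) //= eqxx andbT big1 ?addr0 => [|z /negPf nzy].
      by case: eqP => [->|]; rewrite ?mulr1 ?mulr0.
    by rewrite [y == z]eq_sym nzy andbF mulr0.
  under eq_bigr => z _ do rewrite tensorE !mulrDr.
  rewrite !big_split /= [X in _ + X](_ : _ = 0) ?addr0.
    congr (_ + _); under eq_bigr => z _ do rewrite big_distrr.
      rewrite exchange_big /=; apply: eq_bigr => m _; rewrite !mxE big_distrr.
      by apply: eq_bigr => z _ /=; rewrite mulrCA.
    rewrite exchange_big /=; apply: eq_bigr => m _; rewrite !mxE big_distrl.
    by apply: eq_bigr => z _ /=; rewrite [f m y * _]mulrC mulrA.
  under eq_bigr => z _ do rewrite big_distrr.
  rewrite exchange_big big1 //= => m _.
  under eq_bigr => z _ do rewrite mulrA.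
  by rewrite -big_distrl /= vf mul0r.
have le_k : (\rank (diag_mx v) <= k + k)%N.
  rewrite diagE; apply: leq_trans (mxrank_add _ _) _.
  by apply: leq_add; apply: mulmx_max_rank.
(* The rows and columns picked by [g] cut an identity block out of [diag_mx v]. *)
have : (\rank (kermx C) <= \rank (diag_mx v))%N.
  apply: leq_trans (mxrank_mxsub g g _).
  have -> : mxsub g g (diag_mx v) = 1%:M.
    by apply/matrixP => i j; rewrite !mxE vg (inj_eq g_inj).
  by rewrite mxrank1.
rewrite mxrank_ker; have := rank_leq_col C; lia.
Qed.

(** * Reduction of the solution tensor to low-degree monomials *)

Definition monomial3 (F : comNzRingType) (u : F * nat * nat * nat) (x y z : F) :=
  u.1.1.1 * x ^+ u.1.1.2 * y ^+ u.1.2 * z ^+ u.2.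

Definition degree3 (F : comNzRingType) (u : F * nat * nat * nat) : nat :=
  (u.1.1.2 + u.1.2 + u.2)%N.

(** Like terms are left uncollected, which avoids multinomial coefficients: each further factor
    turns every monomial of the list into three. *)
Lemma linear_form_power (F : comNzRingType) (a b c : F) (d : nat) :
  exists2 s : seq (F * nat * nat * nat), {in s, forall u, degree3 u <= d}%N &
    forall x y z, (a * x + b * y + c * z) ^+ d = \sum_(u <- s) monomial3 u x y z.
Proof.
elim: d => [|d [s deg_s sE]].
  exists [:: (1, 0%N, 0%N, 0%N)] => [u|x y z].
    by rewrite inE => /eqP ->.
  by rewrite big_seq1 /monomial3 /= !expr0 !mulr1.
pose ux (u : F * nat * nat * nat) := (a * u.1.1.1, u.1.1.2.+1, u.1.2, u.2).
pose uy (u : F * nat * nat * nat) := (b * u.1.1.1, u.1.1.2, u.1.2.+1, u.2).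
pose uz (u : F * nat * nat * nat) := (c * u.1.1.1, u.1.1.2, u.1.2, u.2.+1).
exists (map ux s ++ map uy s ++ map uz s) => [u|x y z].
  rewrite !mem_cat => /or3P[] /mapP[t /deg_s + ->]; rewrite /degree3 /=; lia.
rewrite exprS sE !big_cat !big_map /= addrA -!big_split /= big_distrr /=.
by apply: eq_bigr => u _; rewrite /monomial3 /= !exprS; ring.
Qed.

Lemma finField_indicator (F : finFieldType) (x : F) :
  1 - x ^+ #|F|.-1 = (x == 0)%:R.
Proof.
have F1 := card_finNzRing_gt1 F.
have [->|x0] := eqVneq x 0; first by rewrite expr0n gtn_eqF ?subr0 ?ltn_predRL.
suff -> : x ^+ #|F|.-1 = 1 by rewrite subrr.
by apply: (mulfI x0); rewrite -exprS prednK ?expf_card ?mulr1 // ltnW.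
Qed.

Lemma finField_indicator_monomials (F : finFieldType) (a b c : F) :
  exists2 s : seq (F * nat * nat * nat),
    {in s, forall u, degree3 u <= #|F|.-1}%N &
    forall x y z, (a * x + b * y + c * z == 0)%:R = \sum_(u <- s) monomial3 u x y z.
Proof.
have [s deg_s sE] := linear_form_power a b c #|F|.-1.
pose opp (u : F * nat * nat * nat) := (- u.1.1.1, u.1.1.2, u.1.2, u.2).
exists ((1, 0%N, 0%N, 0%N) :: map opp s) => [u|x y z].
  by rewrite inE => /predU1P[->//|/mapP[t /deg_s + ->]].
rewrite -finField_indicator sE big_cons big_map -sumrN; congr (_ + _).
  by rewrite /monomial3 /= !expr0 !mulr1.
by apply: eq_bigr => u _; rewrite /monomial3 /= !mulNr.
Qed.

(* Exponent vectors of the reduced monomials of degree at most Qn/3. *)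
Definition low_degree (n Q : nat) : {set {ffun 'I_n -> 'I_Q.+1}} :=
  [set m : {ffun 'I_n -> 'I_Q.+1} | 3 * \sum_i m i <= Q * n]%N.

Lemma card_le_low_degree (F : finFieldType) (n Q : nat) (a b c : F)
    (A : {set 'rV[F]_n}) :
  #|F| = Q.+1 -> a + b + c = 0 -> only_trivial_solutions a b c A ->
  (#|A| <= 3 * #|low_degree n Q|)%N.
Proof.
move=> cardF abc0 trivA; set M := low_degree n Q.
have [s deg_s sE] := finField_indicator_monomials a b c.
rewrite cardF /= in deg_s.
(* Expanding the product over the coordinates selects one monomial of [s] per coordinate; the
   elements of [E] are these selections. *)
pose E := {ffun 'I_n -> 'I_(size s)}.
pose u (j : 'I_(size s)) := tnth (in_tuple s) j.
have deg_u j : ((u j).1.1.2 + (u j).1.2 + (u j).2 <= Q)%N.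
  by apply: (deg_s (u j)); exact: mem_tnth.
pose mon (m : {ffun 'I_n -> 'I_Q.+1}) (x : 'rV[F]_n) := \prod_i x 0 i ^+ m i.
pose m1 (e : E) : {ffun 'I_n -> 'I_Q.+1} := [ffun i => inord (u (e i)).1.1.2].
pose m2 (e : E) : {ffun 'I_n -> 'I_Q.+1} := [ffun i => inord (u (e i)).1.2].
pose m3 (e : E) : {ffun 'I_n -> 'I_Q.+1} := [ffun i => inord (u (e i)).2].
have m1E e i : m1 e i = (u (e i)).1.1.2 :> nat.
  by rewrite ffunE inordK //; have := deg_u (e i); lia.
have m2E e i : m2 e i = (u (e i)).1.2 :> nat.
  by rewrite ffunE inordK //; have := deg_u (e i); lia.
have m3E e i : m3 e i = (u (e i)).2 :> nat.
  by rewrite ffunE inordK //; have := deg_u (e i); lia.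
pose co (e : E) := \prod_i (u (e i)).1.1.1.
have tensorE (x y z : 'rV[F]_n) : (a *: x + b *: y + c *: z == 0)%:R =
    \sum_e co e * mon (m1 e) x * mon (m2 e) y * mon (m3 e) z.
  transitivity (\prod_i (a * x 0 i + b * y 0 i + c * z 0 i == 0)%:R : F).
    have [/rowP e0|] := eqVneq (a *: x + b *: y + c *: z) 0.
      by rewrite big1 // => i _; have := e0 i; rewrite !mxE => ->; rewrite eqxx.
    move/rV0Pn=> [j]; rewrite !mxE => nj0.
    by rewrite (bigD1 j) //= (negPf nj0) mul0r.
  under eq_bigr => i _ do rewrite sE big_tnth.
  rewrite bigA_distr_bigA /=; apply: eq_bigr => e _.
  rewrite /co /mon -!big_split /=; apply: eq_bigr => i _.
  by rewrite m1E m2E m3E.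
have degE e : (\sum_i m1 e i + \sum_i m2 e i + \sum_i m3 e i <= Q * n)%N.
  rewrite -!big_split /=; apply: (@leq_trans (\sum_(i < n) Q)); last first.
    by rewrite sum_nat_const card_ord mulnC.
  by apply: leq_sum => i _; rewrite m1E m2E m3E; exact: deg_u.
have lowE e : [|| m1 e \in M, m2 e \in M | m3 e \in M].
  rewrite !inE; have := degE e; lia.
(* Terms with the same exponent vector in the distinguished variable merge into one slice, so the
   number of slices is [#|M|] however large [E] is. *)
have sliceE (P : pred E) (p : E -> {ffun 'I_n -> 'I_Q.+1}) (G : E -> F) x :
    (forall e, P e -> p e \in M) -> \sum_(e | P e) mon (p e) x * G e =
    \sum_(k < #|M|) mon (enum_val k) x * \sum_(e | P e && (p e == enum_val k)) G e.
  move=> PM; rewrite (partition_big p (mem M)) //=.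
  rewrite big_enum_val /=; apply: eq_bigr => k _.
  by rewrite big_distrr /=; apply: eq_bigr => e /andP[_ /eqP ->].
(* Each selection is charged to the first of its three exponent vectors that lies in [M]; [lowE]
   ensures that there is one. *)
pose P1 e := m1 e \in M.
pose P2 e := (m1 e \notin M) && (m2 e \in M).
pose P3 e := (m1 e \notin M) && (m2 e \notin M).
apply: (@slice_rank_diagonal F _ _ (fun k i => mon (enum_val k) (enum_val i))
  (fun k i j => \sum_(e | P1 e && (m1 e == enum_val k))
     co e * mon (m2 e) (enum_val i) * mon (m3 e) (enum_val j))
  (fun k i j => \sum_(e | P2 e && (m2 e == enum_val k))
     co e * mon (m1 e) (enum_val i) * mon (m3 e) (enum_val j))
  (fun k i j => \sum_(e | P3 e && (m3 e == enum_val k))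
     co e * mon (m1 e) (enum_val i) * mon (m2 e) (enum_val j))) => i j l.
rewrite -(sliceE P1 m1) // -(sliceE P2 m2) => [|e /andP[] //].
rewrite -(sliceE P3 m3) => [|e /andP[/negPf h1 /negPf h2]]; last first.
  by have := lowE e; rewrite h1 h2.
(* Diagonal triples are solutions because a + b + c = 0; [trivA] gives the converse. *)
have -> : (i == j) && (j == l) =
    (a *: enum_val i + b *: enum_val j + c *: enum_val l == 0).
  apply/andP/eqP => [[/eqP -> /eqP ->]|sol].
    by rewrite -!scalerDl abc0 scale0r.
  have [/enum_val_inj -> /enum_val_inj ->] :=
    trivA _ _ _ (enum_valP i) (enum_valP j) (enum_valP l) sol.
  by [].
rewrite tensorE (bigID P1) /= -addrA; congr (_ + _).
  by apply: eq_bigr => e _; ring.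
rewrite (bigID (fun e => m2 e \in M)) /=; congr (_ + _).
  by apply: eq_bigr => e _; ring.
by apply: eq_bigr => e _; ring.
Qed.

(** * Fourier inversion *)

Local Open Scope classical_set_scope.
Local Open Scope ring_scope.
Local Notation mu := lebesgue_measure.

Lemma complex_sum (R : rcfType) (I : Type) (s : seq I) (P : pred I)
    (f g : I -> R) :
  \sum_(i <- s | P i) (f i +i* g i)%C =
    ((\sum_(i <- s | P i) f i) +i* (\sum_(i <- s | P i) g i))%C.
Proof.
elim: s => [|i s IH]; first by rewrite !big_nil.
by rewrite !big_cons IH; case: (P i).
Qed.

Lemma de_Moivre (R : realType) (t : R) (k : nat) :
  (cos t +i* sin t)%C ^+ k = (cos (k%:R * t) +i* sin (k%:R * t))%C.
Proof.
elim: k => [|k IH]; first by rewrite mul0r cos0 sin0.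
rewrite exprSr IH -natr1 mulrDl mul1r cosD sinD.
by apply/eqP; rewrite eq_complex /=; apply/andP; split; apply/eqP; ring.
Qed.

Lemma abs2_complexX (R : rcfType) (x y : R) (n : nat) :
  let z := (x +i* y)%C ^+ n in
  complex.Re z ^+ 2 + complex.Im z ^+ 2 = (x ^+ 2 + y ^+ 2) ^+ n.
Proof.
elim: n => [|n IH] /=; first by rewrite !expr0 /=; ring.
rewrite [(x +i* y)%C ^+ _]exprS [RHS]exprS -IH /=.
by case: ((x +i* y)%C ^+ n) => a b /=; ring.
Qed.

Section sums_of_iid.
Variables (R : realType) (Q : nat) (w : 'I_Q.+1 -> R).

(** Real and imaginary parts of the characteristic function phi of [w], kept apart so that all
    integrals are of real functions. *)
Definition cosine_sum (t : R) : R := \sum_k w k * cos (k%:R * t).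
Definition sine_sum (t : R) : R := \sum_k w k * sin (k%:R * t).
Definition charfun_norm (t : R) : R :=
  Num.sqrt (cosine_sum t ^+ 2 + sine_sum t ^+ 2).

Definition weight n (e : {ffun 'I_n -> 'I_Q.+1}) : R := \prod_i w (e i).
Definition total n (e : {ffun 'I_n -> 'I_Q.+1}) : nat := (\sum_i e i)%N.

(** When [w] is a probability law, this is P(S_n = m) for the sum S_n of n independent variables of
    law [w]. *)
Definition sum_law (n m : nat) : R :=
  \sum_(e : {ffun 'I_n -> 'I_Q.+1} | total e == m) weight e.

Lemma charfunX (n : nat) (t : R) :
  (cosine_sum t +i* sine_sum t)%C ^+ n =
  ((\sum_(e : {ffun 'I_n -> 'I_Q.+1}) weight e * cos ((total e)%:R * t)) +i*
   (\sum_(e : {ffun 'I_n -> 'I_Q.+1}) weight e * sin ((total e)%:R * t)))%C.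
Proof.
have -> : (cosine_sum t +i* sine_sum t)%C =
    \sum_k (w k)%:C%C * (cos t +i* sin t)%C ^+ k.
  rewrite -complex_sum; apply: eq_bigr => k _.
  by rewrite de_Moivre; apply/eqP; rewrite eq_complex /= !mul0r subr0 addr0 !eqxx.
rewrite -[in LHS](card_ord n) -prodr_const bigA_distr_bigA /= -complex_sum.
apply: eq_bigr => e _.
rewrite big_split /= prodrXr de_Moivre -(rmorph_prod (real_complex R)).
by apply/eqP; rewrite eq_complex /= !mul0r subr0 addr0 !eqxx.
Qed.

(** The left side is the real part of phi(t)^n exp(-imt), hence at most its modulus. *)
Lemma charfunX_shift_le (n m : nat) (t : R) :
  \sum_(e : {ffun 'I_n -> 'I_Q.+1}) weight e * cos (((total e)%:R - m%:R) * t)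
    <= charfun_norm t ^+ n.
Proof.
have := abs2_complexX (cosine_sum t) (sine_sum t) n.
rewrite charfunX /=; set U := \sum_e _; set V := \sum_e _ => UV.
have -> : \sum_(e : {ffun 'I_n -> 'I_Q.+1})
    weight e * cos (((total e)%:R - m%:R) * t)
    = U * cos (m%:R * t) + V * sin (m%:R * t).
  rewrite !big_distrl -big_split /=; apply: eq_bigr => e _.
  by rewrite mulrBl cosB; ring.
apply: le_trans (ler_norm _) _.
rewrite -(ler_pXn2r (ltn0Sn 1)) ?nnegrE ?exprn_ge0 ?sqrtr_ge0 //.
rewrite real_normK ?num_real // -exprM mulnC exprM sqr_sqrtr ?addr_ge0 ?sqr_ge0 //.
rewrite -UV; have := cos2Dsin2 (m%:R * t) => cs.
rewrite -[leRHS]mulr1 -[X in _ <= _ * X]cs -subr_ge0.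
set co := cos _; set si := sin _.
(* Lagrange's identity, giving Cauchy-Schwarz in the plane. *)
rewrite (_ : _ - _ = (U * si - V * co) ^+ 2) ?sqr_ge0 //; ring.
Qed.

End sums_of_iid.

Lemma continuous_sumr (R : realType) (I : Type) (s : seq I) (f : I -> R -> R) :
  (forall i, continuous (f i)) -> continuous (fun t => \sum_(i <- s) f i t).
Proof.
move=> fc; elim: s => [|i s IH] t.
  by under eq_fun => x do rewrite big_nil; apply: cvg_cst.
under eq_fun => x do rewrite big_cons.
by apply: cvgD; [exact: fc|exact: IH].
Qed.

Lemma continuous_Rintegrable (R : realType) (f : R -> R) (a b : R) :
  continuous f -> mu.-integrable `[a, b] (EFin \o f).
Proof.
move=> fc; apply: continuous_compact_integrable; first exact: segment_compact.
exact: continuous_subspaceT.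
Qed.

Lemma Rintegral_sum_continuous (R : realType) (I : Type) (s : seq I)
    (f : I -> R -> R) (a b : R) : (forall i, continuous (f i)) ->
  \int[mu]_(t in `[a, b]) (\sum_(i <- s) f i t) =
  \sum_(i <- s) \int[mu]_(t in `[a, b]) f i t.
Proof.
move=> fc; elim: s => [|i s IH].
  under eq_Rintegral => t _ do rewrite big_nil.
  by rewrite big_nil Rintegral_cst ?mul0r.
under eq_Rintegral => t _ do rewrite big_cons.
rewrite big_cons -IH RintegralD //; apply: continuous_Rintegrable => //.
exact: continuous_sumr.
Qed.

Lemma continuous_cosM (R : realType) (a : R) : continuous (fun t => cos (a * t)).
Proof.
move=> t; apply: (continuous_comp _ (@continuous_cos R (a * t))).
exact: mulrl_continuous.
Qed.

Lemma continuous_sinM (R : realType) (a : R) : continuous (fun t => sin (a * t)).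
Proof.
move=> t; apply: (continuous_comp _ (@continuous_sin R (a * t))).
exact: mulrl_continuous.
Qed.

Lemma sin_natpi (R : realType) (k : nat) : sin (k%:R * pi) = 0 :> R.
Proof.
elim: k => [|k IH]; first by rewrite mul0r sin0.
by rewrite -natr1 mulrDl mul1r sinDpi IH oppr0.
Qed.

(** For distinct s and m the antiderivative sin(at)/a, with a a nonzero integer, vanishes at both
    ends of the period. *)
Lemma Rintegral_cos_sub (R : realType) (s m : nat) :
  \int[mu]_(t in `[- pi, pi]) cos ((s%:R - m%:R) * t) = (2 * pi) *+ (s == m) :> R.
Proof.
have pi0 := pi_gt0 R.
have [->|nsm] := eqVneq s m.
  rewrite subrr; under eq_Rintegral => t _ do rewrite mul0r cos0.
  rewrite Rintegral_cst //= lebesgue_measure_itv /= lte_fin ifT /=; last lra.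
  by rewrite mul1r; lra.
set a : R := s%:R - m%:R.
have a0 : a != 0 by rewrite subr_eq0 eqr_nat.
pose F : R -> R := a^-1 \*: (@sin R \o (a \*: @idfun R)).
have dF (t : R) : is_derive t (1 : R) F (cos (a * t)).
  apply: is_derive_eq; rewrite /=.
  by rewrite -![_ *: _]/(_ * _) mulr1 mulrCA mulVf ?mulr1.
rewrite /Rintegral (@continuous_FTC2 _ _ F) /=.
- have sa : sin (a * pi) = 0.
    by rewrite mulrBl sinB !sin_natpi mul0r mulr0 subrr.
  rewrite /F /= -![_ *: _]/(_ * _) /=.
  by rewrite mulrN sinN sa oppr0 mulr0 subrr mulr0n.
- lra.
- exact/continuous_subspaceT/continuous_cosM.
- have cF (t : R) : F x @[x --> t] --> F t.
    by apply/differentiable_continuous/derivable1_diffP; case: (dF t).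
  split; first by move=> t _; case: (dF t).
    exact/cvg_at_right_filter/cF.
  exact/cvg_at_left_filter/cF.
- by move=> t _; rewrite derive1E; case: (dF t).
Qed.

Section inversion.
Variables (R : realType) (Q : nat) (w : 'I_Q.+1 -> R).

Lemma continuous_charfun_normX n : continuous (fun t => charfun_norm w t ^+ n).
Proof.
move=> t; apply: (continuous_comp _ (@exprn_continuous R n _)).
apply: (continuous_comp _ (@sqrt_continuous R _)).
have cc : {for t, continuous (cosine_sum w)}.
  by apply: continuous_sumr => i x;
     apply: cvgM; [exact: cvg_cst|exact: continuous_cosM].
have cs : {for t, continuous (sine_sum w)}.
  by apply: continuous_sumr => i x;
     apply: cvgM; [exact: cvg_cst|exact: continuous_sinM].
by apply: cvgD; apply: (continuous_comp _ (@exprn_continuous R 2 _)).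
Qed.

(** By orthogonality the left side is the integral of the real part of phi^n exp(-imt). Passing to
    the modulus makes the bound uniform in m. *)
Lemma sum_law_le (n m : nat) :
  2 * pi * sum_law w n m <= \int[mu]_(t in `[- pi, pi]) charfun_norm w t ^+ n.
Proof.
have -> : 2 * pi * sum_law w n m = \int[mu]_(t in `[- pi, pi])
    \sum_(e : {ffun 'I_n -> 'I_Q.+1})
      weight w e * cos (((total e)%:R - m%:R) * t).
  rewrite Rintegral_sum_continuous => [|e t]; last first.
    by apply: cvgM; [exact: cvg_cst|exact: continuous_cosM].
  rewrite /sum_law big_distrr big_mkcond /=; apply: eq_bigr => e _.
  rewrite RintegralZl ?Rintegral_cos_sub //=; last first.
    exact/continuous_Rintegrable/continuous_cosM.
  by case: eqP => _; rewrite ?mulr1n ?mulr0n ?mulr0 // mulrC.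
apply: le_Rintegral => //.
- apply: continuous_Rintegrable; apply: continuous_sumr => e t.
  by apply: cvgM; [exact: cvg_cst|exact: continuous_cosM].
- exact/continuous_Rintegrable/continuous_charfun_normX.
- by move=> t _; exact: charfunX_shift_le.
Qed.
End inversion.

(** * Local limit upper bound *)

Lemma sin_mean_value (R : realType) (y : R) : 0 < y ->
  exists2 c : R, 0 < c < y & sin y = cos c * y.
Proof.
move=> y0.
have [c + E] := MVT y0 (fun x _ => is_derive_sin x)
  (continuous_subspaceT (@continuous_sin R)).
rewrite in_itv /= => ?; exists c => //.
by move: E; rewrite sin0 !subr0.
Qed.

Lemma sqr_sin_le (R : realType) (y : R) : sin y ^+ 2 <= y ^+ 2.
Proof.
wlog y0 : y / 0 < y.
  move=> H; have [/H//|y0|<-] := ltgtP 0 y; last by rewrite sin0.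
  by rewrite -sqrrN -sinN -[y ^+ 2]sqrrN H // oppr_gt0.
have [c _ ->] := sin_mean_value y0.
rewrite exprMn cos2sin2.
have := sqr_ge0 (sin c); have := sqr_ge0 y; nra.
Qed.

(** For y > 0, the mean value c < y gives sin(y)^2 = y^2 (1 - sin(c)^2), and sin(c)^2 <= c^2 <=
    y^2. *)
Lemma sqr_sin_ge (R : realType) (y : R) : y ^+ 2 * (1 - y ^+ 2) <= sin y ^+ 2.
Proof.
wlog y0 : y / 0 < y.
  move=> H; have [/H//|y0|<-] := ltgtP 0 y; last by rewrite sin0 expr0n mul0r.
  by rewrite -[sin y ^+ 2]sqrrN -sinN -[y ^+ 2]sqrrN H // oppr_gt0.
have [c /andP[c0 cy] ->] := sin_mean_value y0.
rewrite exprMn cos2sin2 mulrC ler_wpM2r ?sqr_ge0 // lerD2l lerN2.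
apply: le_trans (sqr_sin_le c) _.
by rewrite ler_pXn2r ?nnegrE ?ltW // (lt_trans c0).
Qed.

Lemma oneBcosE (R : realType) (x : R) : 1 - cos x = 2 * sin (x / 2) ^+ 2.
Proof.
have -> : cos x = cos ((x / 2) *+ 2) by congr cos; rewrite mulr2n; lra.
by rewrite cos_mulr2n cos2sin2 mulr2n; lra.
Qed.

(** The integrand is sqrt(pi/c) times the centred normal density of variance 1/(2c), whose mass on
    the whole line is 1. *)
Lemma Rintegral_gauss_le (R : realType) (c : R) : 0 < c ->
  \int[mu]_(t in `[- pi, pi]) expR (- (c * t ^+ 2)) <= Num.sqrt (pi / c).
Proof.
move=> c0; pose s := Num.sqrt (2 * c)^-1.
have c20 : 0 < (2 * c)^-1 by rewrite invr_gt0; lra.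
have s0 : s != 0 by rewrite gt_eqF // sqrtr_gt0.
have s2 : s ^+ 2 = (2 * c)^-1 by rewrite sqr_sqrtr // ltW.
have peak0 := normal_peak_gt0 s0.
have peakE : (normal_peak s)^-1 = Num.sqrt (pi / c).
  rewrite /normal_peak invrK s2; congr Num.sqrt.
  by rewrite -mulr_natl; field; rewrite gt_eqF.
have -> : (fun t => expR (- (c * t ^+ 2))) =
    (fun t => Num.sqrt (pi / c) * normal_pdf 0 s t).
  apply/funext => t; rewrite normal_pdfE // -peakE.
  rewrite -[RHS]/((normal_peak s)^-1 * (normal_peak s * normal_fun 0 s t)).
  rewrite mulrA mulVf ?gt_eqF // mul1r.
  rewrite /normal_fun s2 subr0; congr expR.
  by rewrite -mulr_natl; field; rewrite gt_eqF.
have ipdf := @integrable_normal_pdf R 0 s.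
have ipdf' : mu.-integrable `[- pi, pi : R] (EFin \o normal_pdf 0 s).
  by apply: integrableS ipdf.
rewrite RintegralZl // ler_piMr ?sqrtr_ge0 //.
rewrite -lee_fin fineK; last exact: integrable_fin_num.
rewrite -(@integral_normal_pdf R 0 s); apply: ge0_subset_integral => //=.
  by apply/measurable_realfun.measurable_EFinP; exact: measurable_normal_pdf.
by move=> t _; rewrite lee_fin normal_pdf_ge0.
Qed.

Lemma ler_term_sum2 (R : numDomainType) (I J : finType) (f : I -> J -> R) i0 j0 :
  (forall i j, 0 <= f i j) -> f i0 j0 <= \sum_i \sum_j f i j.
Proof.
move=> f0; rewrite (bigD1 i0) //= (bigD1 j0) //= -addrA lerDl addr_ge0 //.
  by apply: sumr_ge0.
by apply: sumr_ge0 => i _; apply: sumr_ge0.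
Qed.

Lemma bernoulli_ge (R : realDomainType) (h : R) n :
  0 <= h -> 1 + n%:R * h <= (1 + h) ^+ n.
Proof.
move=> h0; elim: n => [|n IH]; first by rewrite mul0r addr0 expr0.
rewrite exprS -natr1.
apply: (@le_trans _ _ ((1 + h) * (1 + n%:R * h))); last first.
  by rewrite ler_wpM2l //; lra.
have : 0 <= n%:R * h * h by rewrite !mulr_ge0.
lra.
Qed.

Section local_limit.
Variables (R : realType) (Q : nat) (w : 'I_Q.+1 -> R).
Hypotheses (Q0 : (0 < Q)%N) (w_gt0 : forall k, 0 < w k) (w_sum : \sum_k w k = 1).

(* Half the mean squared difference of two independent copies: this is the
   variance, and the form in which it appears in [charfun_norm_sqr]. *)
Definition weights_variance : R :=
  \sum_j \sum_k w j * w k * ((j%:R - k%:R) ^+ 2 / 2).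
Local Notation s2 := weights_variance.

Let ww_ge0 j k : 0 <= w j * w k.
Proof. by rewrite mulr_ge0 // ltW. Qed.

(** The square of |phi| is the characteristic function of the difference of two independent copies,
    which is real. *)
Lemma charfun_norm_sqr t : charfun_norm w t ^+ 2 =
  1 - \sum_j \sum_k w j * w k * (1 - cos ((j%:R - k%:R) * t)).
Proof.
rewrite sqr_sqrtr ?addr_ge0 ?sqr_ge0 //.
rewrite [X in _ = X - _](_ : 1 = \sum_j \sum_k w j * w k); last first.
  by under eq_bigr => j _ do rewrite -big_distrr /= w_sum mulr1.
rewrite -sumrB /cosine_sum /sine_sum !expr2 !big_distrl -big_split /=.
apply: eq_bigr => j _.
rewrite !big_distrr -sumrB -big_split /=; apply: eq_bigr => k _.
by rewrite mulrBl cosB; ring.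
Qed.

(** With y = (j - k)t/2 each term is 2 sin(y)^2 >= 2 y^2 (1 - y^2), and |j - k| <= Q makes the
    correction the same for all pairs. *)
Lemma charfun_norm_near0 t :
  charfun_norm w t ^+ 2 <= 1 - s2 * t ^+ 2 * (1 - (Q%:R * t / 2) ^+ 2).
Proof.
rewrite charfun_norm_sqr lerD2l lerN2 -mulrA /s2 !big_distrl /=.
apply: ler_sum => j _; rewrite big_distrl /=; apply: ler_sum => k _.
rewrite -[leLHS]mulrA ler_wpM2l ?ww_ge0 //.
rewrite oneBcosE.
set y := (j%:R - k%:R) * t / 2.
apply: (@le_trans _ _ (2 * (y ^+ 2 * (1 - y ^+ 2)))); last first.
  by rewrite ler_wpM2l // sqr_sin_ge.
have jk : (j%:R - k%:R) ^+ 2 <= Q%:R ^+ 2 :> R.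
  have hj : j%:R <= Q%:R :> R by rewrite ler_nat -ltnS.
  have hk : k%:R <= Q%:R :> R by rewrite ler_nat -ltnS.
  have j0 : 0 <= j%:R :> R by [].
  have k0 : 0 <= k%:R :> R by [].
  nra.
have yQ : y ^+ 2 <= (Q%:R * t / 2) ^+ 2.
  rewrite /y !exprMn ler_wpM2r ?sqr_ge0 // ler_wpM2r ?sqr_ge0 //.
rewrite (_ : (j%:R - k%:R) ^+ 2 / 2 * _ =
  2 * (y ^+ 2 * (1 - (Q%:R * t / 2) ^+ 2))); last by rewrite /y; field.
by rewrite ler_wpM2l // ler_wpM2l ?sqr_ge0 // lerD2l lerN2.
Qed.

Let one : 'I_Q.+1 := inord 1.
Let oneE : one = 1%N :> nat. Proof. by rewrite inordK. Qed.

Lemma weights_variance_gt0 : 0 < s2.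
Proof.
apply: (@lt_le_trans _ _ (w ord0 * w one * ((ord0%:R - one%:R) ^+ 2 / 2))).
  rewrite oneE sub0r sqrrN expr1n !mulr_gt0 //.
apply: (ler_term_sum2 (f := fun j k => w j * w k * ((j%:R - k%:R) ^+ 2 / 2))).
by move=> j k; rewrite mulr_ge0 ?ww_ge0 // mulr_ge0 ?sqr_ge0.
Qed.

(** Only the pair (0, 1) is kept. Its difference is 1, so its cosine is decreasing in |t| up to pi
    and does not return to 1 within the period. *)
Lemma charfun_norm_far (d t : R) : 0 <= d -> d <= `|t| <= pi ->
  charfun_norm w t ^+ 2 <= 1 - w ord0 * w one * (1 - cos d).
Proof.
move=> d0 /andP[dt tpi].
rewrite charfun_norm_sqr lerD2l lerN2.
apply: (@le_trans _ _ (w ord0 * w one * (1 - cos ((0%:R - one%:R) * t)))).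
  rewrite ler_wpM2l ?ww_ge0 // lerD2l lerN2.
  rewrite oneE sub0r mulN1r cosN -cos_norm leNgt ltr_cos ?in_itv /= ?normr_ge0 ?tpi //.
    by rewrite -leNgt.
  by rewrite d0 (le_trans dt).
apply: (ler_term_sum2 (f := fun j k => w j * w k * (1 - cos ((j%:R - k%:R) * t)))).
by move=> j k; rewrite mulr_ge0 ?ww_ge0 // subr_ge0 cos_le1.
Qed.

Lemma charfun_norm_ge0 t : 0 <= charfun_norm w t.
Proof. exact: sqrtr_ge0. Qed.

(** Widening the Gaussian by [kappa] absorbs the quartic correction near 0. Adding the two bounds,
    instead of choosing between them, avoids splitting the integral later. *)
Lemma charfun_norm_gauss (kappa : R) : 1 < kappa ->
  exists2 rho : R, 0 < rho < 1 & forall (n : nat) t, `|t| <= pi ->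
    charfun_norm w t ^+ n <=
    expR (- (n%:R * s2 / (2 * kappa ^+ 2) * t ^+ 2)) + rho ^+ n.
Proof.
move=> k1.
have kV : kappa ^- 2 < 1 by rewrite invf_lt1 ?exprn_egt1 // exprn_gt0 //; lra.
have Q1 : 0 < Q%:R :> R by rewrite ltr0n.
(* Chosen so that |t| < d implies (Qt/2)^2 <= 1 - kappa^-2. *)
pose d : R := Num.min pi (2 * Num.sqrt (1 - kappa ^- 2) / Q%:R).
have d0 : 0 < d.
  by rewrite lt_min pi_gt0 divr_gt0 // mulr_gt0 // sqrtr_gt0 subr_gt0.
have dpi : d <= pi by rewrite ge_min lexx.
have cosd : cos d < 1.
  by rewrite -cos0 ltr_cos // in_itv /= ?lexx ?pi_ge0 // (ltW d0).
(* The maximum with 1/2 only serves to keep [rho2] positive. *)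
pose rho2 : R := Num.max (1 / 2) (1 - w ord0 * w one * (1 - cos d)).
have rho2_lt1 : rho2 < 1.
  rewrite gt_max; apply/andP; split; first lra.
  by rewrite ltrBlDr ltrDl !mulr_gt0 // subr_gt0.
have rho2_gt0 : 0 < rho2 by rewrite lt_max divr_gt0.
exists (Num.sqrt rho2).
  by rewrite sqrtr_gt0 rho2_gt0 -sqrtr1 ltr_sqrt.
move=> n t tpi; have [dt|td] := lerP d `|t|.
  apply: (@le_trans _ _ (Num.sqrt rho2 ^+ n)); last by rewrite lerDr expR_ge0.
  apply: lerXn2r; rewrite ?nnegrE ?sqrtr_ge0 ?charfun_norm_ge0 //.
  rewrite -(ler_pXn2r (ltn0Sn 1)) ?nnegrE ?sqrtr_ge0 //.
  rewrite [Num.sqrt rho2 ^+ 2]sqr_sqrtr ?(ltW rho2_gt0) // le_max; apply/orP; right.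
  by apply: charfun_norm_far; rewrite ?(ltW d0) ?dt.
apply: (@le_trans _ _ (expR (- (n%:R * s2 / (2 * kappa ^+ 2) * t ^+ 2)))); last first.
  by rewrite lerDl exprn_ge0 ?sqrtr_ge0.
have -> : - (n%:R * s2 / (2 * kappa ^+ 2) * t ^+ 2) =
    n%:R * (- (s2 / (2 * kappa ^+ 2) * t ^+ 2)) by ring.
rewrite expRM_natl; apply: lerXn2r; rewrite ?nnegrE ?expR_ge0 ?charfun_norm_ge0 //.
rewrite -(ler_pXn2r (ltn0Sn 1)) ?nnegrE ?expR_ge0 ?charfun_norm_ge0 //.
rewrite -expRM_natl.
apply: le_trans (charfun_norm_near0 t) _.
apply: le_trans (expR_ge1Dx _).
rewrite lerD2l.
have -> : 2%:R * - (s2 / (2 * kappa ^+ 2) * t ^+ 2) = - (s2 * t ^+ 2 * kappa ^- 2).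
  by field; lra.
rewrite lerN2 ler_wpM2l //.
  by rewrite mulr_ge0 ?sqr_ge0 // ltW // weights_variance_gt0.
rewrite lerBrDr addrC -lerBrDr.
have tQ : (Q%:R * `|t| / 2) <= Num.sqrt (1 - kappa ^- 2).
  move: td; rewrite lt_min => /andP[_ /ltW]; rewrite ler_pdivlMr //; lra.
have : (Q%:R * `|t| / 2) ^+ 2 <= Num.sqrt (1 - kappa ^- 2) ^+ 2.
  by apply: lerXn2r tQ; rewrite nnegrE ?sqrtr_ge0 // !mulr_ge0.
rewrite sqr_sqrtr ?subr_ge0 ?(ltW kV) //.
by rewrite !exprMn real_normK ?num_real.
Qed.

Local Notation J n := (\int[mu]_(t in `[- pi, pi]) charfun_norm w t ^+ n).

Lemma charfun_integral_le (kappa : R) : 1 < kappa ->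
  exists2 rho : R, 0 < rho < 1 & forall n : nat, (0 < n)%N ->
    J n <= kappa * Num.sqrt (2 * pi / (n%:R * s2)) + rho ^+ n * (2 * pi).
Proof.
move=> k1; have [rho rho01 H] := charfun_norm_gauss k1; exists rho => // n n0.
have s20 := weights_variance_gt0; have pi0 := pi_gt0 R.
have nR : 0 < n%:R :> R by rewrite ltr0n.
set c := n%:R * s2 / (2 * kappa ^+ 2).
have c0 : 0 < c by rewrite divr_gt0 ?mulr_gt0 ?exprn_gt0 //; lra.
have cg : continuous (fun t : R => expR (- (c * t ^+ 2))).
  move=> t; apply: (cvg_comp (fun x => - (c * x ^+ 2)) expR); last first.
    exact: continuous_expR.
  apply: (@cvgN _ R^o); apply: cvgM; [exact: cvg_cst|exact: exprn_continuous].
apply: (@le_trans _ _ (\int[mu]_(t in `[- pi, pi])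
    (expR (- (c * t ^+ 2)) + rho ^+ n))).
  apply: le_Rintegral => //.
  - exact/continuous_Rintegrable/continuous_charfun_normX.
  - apply: continuous_Rintegrable => t; apply: cvgD; [exact: cg|exact: cvg_cst].
  - by move=> t /=; rewrite in_itv /= => tpi; apply: H; rewrite ler_norml.
rewrite RintegralD //; [|exact: continuous_Rintegrable|]; last first.
  by apply: continuous_Rintegrable => t; exact: cvg_cst.
apply: lerD.
  apply: le_trans (Rintegral_gauss_le c0) _.
  have kE : kappa = Num.sqrt (kappa ^+ 2) by rewrite sqrtr_sqr ger0_norm //; lra.
  rewrite [X in _ <= X * _]kE -sqrtrM ?sqr_ge0 // /c.
  rewrite le_eqVlt; apply/orP; left; apply/eqP; congr Num.sqrt.
  by field; rewrite !gt_eqF //; lra.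
rewrite Rintegral_cst //= lebesgue_measure_itv /= lte_fin ifT /=; last lra.
rewrite ler_wpM2l ?exprn_ge0 //; lra.
Qed.

Lemma local_limit_upper : exists eps : nat -> R,
  [/\ eps n @[n --> \oo] --> (0 : R), forall n, 0 <= eps n &
    forall n m : nat, (0 < n)%N ->
      sum_law w n m <= (1 + eps n) / (Num.sqrt s2 * Num.sqrt (2 * pi * n%:R))].
Proof.
have s20 := weights_variance_gt0; have pi0 := pi_gt0 R.
pose K (n : nat) := Num.sqrt (n%:R * s2 / (2 * pi)).
(* [K n] is the inverse of the Gaussian main term sqrt(2 pi / (n s2)), so [eps n] is the relative
   excess of the integral, cut off at 0. It does not depend on m. *)
pose eps (n : nat) := Num.max 0 (K n * J n - 1).
exists eps; split.
- apply/cvgrPdist_le => /= e e0.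
  have k1 : 1 < 1 + e / 2 by lra.
  have [rho /andP[rho0 rho1] H] := charfun_integral_le k1.
  (* Bernoulli's inequality for rho^-1 = 1 + h gives rho^n <= 1/(nh), which beats the growth of
     [K n] like sqrt(n). *)
  pose h := rho^-1 - 1.
  have h0 : 0 < h by rewrite subr_gt0 invf_gt1.
  pose D := Num.sqrt (s2 / (2 * pi)) * (2 * pi).
  have D0 : 0 < D by rewrite mulr_gt0 ?sqrtr_gt0 ?divr_gt0 ?mulr_gt0.
  near=> n.
  have n0 : (0 < n)%N by near: n; exact: nbhs_infty_gt.
  have nR : 0 < n%:R :> R by rewrite ltr0n.
  have nbig : (2 * D / (h * e)) ^+ 2 <= n%:R by near: n; exact: nbhs_infty_ger.
  rewrite sub0r normrN ger0_norm; last by rewrite le_max lexx.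
  rewrite ge_max (ltW e0) /= lerBlDr.
  have K0 : 0 < K n by rewrite sqrtr_gt0 divr_gt0 ?mulr_gt0.
  apply: le_trans (_ : K n * ((1 + e / 2) * Num.sqrt (2 * pi / (n%:R * s2))
    + rho ^+ n * (2 * pi)) <= _).
    by rewrite ler_wpM2l ?(ltW K0) // H.
  have K1 : K n * Num.sqrt (2 * pi / (n%:R * s2)) = 1.
    rewrite -sqrtrM; last by rewrite divr_ge0 ?mulr_ge0 ?(ltW s20) ?(ltW pi0).
    by rewrite -[X in _ * X]invf_div divff ?sqrtr1 // gt_eqF // divr_gt0 ?mulr_gt0.
  rewrite mulrDr mulrCA K1 mulr1.
  suff : K n * (rho ^+ n * (2 * pi)) <= e / 2 by lra.
  have rhon : rho ^+ n <= (n%:R * h)^-1.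
    rewrite -[rho]invrK exprVn lef_pV2 ?posrE ?mulr_gt0 ?exprn_gt0 ?invr_gt0 //.
    have -> : rho^-1 = 1 + h by rewrite /h; lra.
    by apply: le_trans (bernoulli_ge n (ltW h0)); rewrite lerDr.
  have KE : K n = Num.sqrt n%:R * Num.sqrt (s2 / (2 * pi)).
    by rewrite -sqrtrM ?(ltW nR) // mulrA.
  have sn0 : 0 < Num.sqrt n%:R :> R by rewrite sqrtr_gt0.
  have snE : Num.sqrt n%:R ^+ 2 = n%:R :> R by rewrite sqr_sqrtr // ltW.
  apply: le_trans (_ : D / (Num.sqrt n%:R * h) <= _).
    rewrite KE (_ : _ * _ = Num.sqrt n%:R * D * rho ^+ n); last by rewrite /D; ring.
    apply: le_trans (_ : Num.sqrt n%:R * D * (n%:R * h)^-1 <= _).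
      by apply: ler_wpM2l => //; apply: mulr_ge0; exact: ltW.
    rewrite -{2}snE le_eqVlt; apply/orP; left; apply/eqP.
    by field; rewrite !gt_eqF.
  rewrite ler_pdivrMr ?mulr_gt0 //.
  have : 2 * D / (h * e) <= Num.sqrt n%:R.
    rewrite -(ler_pXn2r (ltn0Sn 1)) ?nnegrE ?(ltW sn0) ?snE //.
    by apply: divr_ge0; apply: mulr_ge0 => //; exact: ltW.
  rewrite ler_pdivrMr ?mulr_gt0 //; lra.
- by move=> n; rewrite le_max lexx.
move=> n m n0.
have nR : 0 < n%:R :> R by rewrite ltr0n.
have K0 : 0 < K n by rewrite sqrtr_gt0 divr_gt0 ?mulr_gt0.
have KJ : K n * J n <= 1 + eps n by rewrite -lerBlDl le_max lexx orbT.
have := sum_law_le w n m; rewrite -(ler_pM2l K0) => /le_trans/(_ KJ).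
have -> : K n * (2 * pi * sum_law w n m) =
   sum_law w n m * (Num.sqrt s2 * Num.sqrt (2 * pi * n%:R)).
  have -> : Num.sqrt s2 * Num.sqrt (2 * pi * n%:R) = K n * (2 * pi).
    rewrite -sqrtrM ?(ltW s20) // /K.
    rewrite -[X in _ = _ * X]ger0_norm; last by rewrite mulr_ge0 ?(ltW pi0).
    rewrite -sqrtr_sqr -sqrtrM ?divr_ge0 ?mulr_ge0 ?(ltW pi0) ?(ltW s20) //.
    congr Num.sqrt; move: pi0; move: (pi : R) => p p0.
    by field; rewrite gt_eqF.
  by ring.
by rewrite ler_pdivlMr // mulr_gt0 // sqrtr_gt0 ?mulr_gt0.
Unshelve. all: by end_near.
Qed.

End local_limit.

(** * The tilted law and the critical point of [fq] *)

Lemma mulr_deriv_poly (R : comNzRingType) (n : nat) (c : nat -> R) (x : R) :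
  x * (\poly_(i < n) c i)^`().[x] = \sum_(i < n) i%:R * c i * x ^+ i.
Proof.
rewrite -[X in X * _]hornerX -hornerM.
have -> : 'X * (\poly_(i < n) c i)^`() = \poly_(i < n) (i%:R * c i).
  apply/polyP => i; rewrite coefXM coef_deriv !coef_poly.
  case: i => [|i] /=; first by case: ifP; rewrite ?mul0r.
  by case: ifP; rewrite ?mul0rn // mulr_natl.
by rewrite horner_poly.
Qed.

Lemma powR_mulB1 (R : realType) (a x : R) : 0 < x ->
  x `^ a = x * x `^ (a - 1).
Proof.
move=> x0; rewrite -[X in X * _](powRr1 (ltW x0)) -powRD.
  by congr (_ `^ _); ring.
by rewrite (gt_eqF x0) implybT.
Qed.

Section critical_point.
Variables (R : realType) (Q : nat).
(** The exponent in the denominator of [fq]; at the minimum it is the mean of the tilted law. *)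
Let mean : R := (Q.+1%:R - 1) / 3.
Let G : {poly R} := \poly_(i < Q.+1) 1.
Let H : {poly R} := \poly_(i < Q.+1) (i%:R - mean).

Lemma fqE : @fq R Q.+1 = horner G * (@powR R)^~ (- mean).
Proof.
apply/funext => x; rewrite /fq fctE /= powRN horner_poly; congr (_ / _).
by apply: eq_bigr => i _; rewrite mul1r.
Qed.

Lemma is_derive_fq (x : R) : 0 < x ->
  is_derive x (1 : R) (@fq R Q.+1) (H.[x] * x `^ (- mean - 1)).
Proof.
move=> x0; rewrite fqE.
have dG := is_derive_poly G x.
have dp := is_derive1_powR (- mean) x0.
apply: is_derive_eq.
rewrite /= -![_ *: _]/(_ * _).
have -> : H.[x] = x * G^`().[x] - mean * G.[x].
  rewrite mulr_deriv_poly !horner_poly big_distrr -sumrB /=.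
  by apply: eq_bigr => i _; ring.
by rewrite (powR_mulB1 (- mean) x0); ring.
Qed.

Variable r : R.
Hypotheses (r0 : 0 < r) (hmin : forall x : R, 0 < x -> fq Q.+1 r <= fq Q.+1 x).

Lemma fq_critical : \sum_(i < Q.+1) (i%:R - mean) * r ^+ i = 0.
Proof.
have d0 : is_derive r (1 : R) (@fq R Q.+1) 0.
  (* The interior minimum criterion is applied on the interval from 0 to r + 1. *)
  have r1 : 0 <= r + 1 :> R by rewrite addr_ge0 // ltW.
  apply: (derive1_at_min r1) => [t||t].
  - by rewrite in_itv /= => /andP[t0 _]; case: (is_derive_fq t0).
  - by rewrite in_itv /= r0 ltrDl ltr01.
  - by rewrite in_itv /= => /andP[t0 _]; apply: hmin.
have : H.[r] * r `^ (- mean - 1) = 0.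
  by case: d0 => _ <-; case: (is_derive_fq r0) => _ ->.
move/eqP; rewrite mulf_eq0 [_ `^ _ == 0]gt_eqF ?powR_gt0 // orbF.
by rewrite horner_poly => /eqP.
Qed.

(** Differentiating f' = H(x) x^(-mean-1) at r leaves only the term with H'(r), since H(r) = 0
    there. *)
Lemma fq_derive2 : derive1n 2 (@fq R Q.+1) r =
  (\sum_(i < Q.+1) i%:R * (i%:R - mean) * r ^+ i) * r `^ (- mean) / r ^+ 2.
Proof.
rewrite derive1nS derive1E.
have dH := is_derive_poly H r.
have dp := is_derive1_powR (- mean - 1) r0.
have E : \near r, horner H r * r `^ (- mean - 1) = (@fq R Q.+1)^`(1)%classic r.
  near=> x; have x0 : 0 < x by near: x; exact: lt_nbhsr.
  by rewrite derive1n1 derive1E; case: (is_derive_fq x0) => _ ->.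
have := near_eq_is_derive E (is_deriveM dH dp).
case=> _ -> /=; rewrite -![_ *: _]/(_ * _).
have -> : H.[r] = 0 by rewrite horner_poly fq_critical.
rewrite mul0r add0r -(mulr_deriv_poly Q.+1 (fun i => i%:R - mean) r) -/H.
rewrite [r `^ (- mean)](powR_mulB1 _ r0).
by field; rewrite gt_eqF.
Unshelve. all: by end_near.
Qed.

Let g := \sum_(i < Q.+1) r ^+ i.
Definition tilted (k : 'I_Q.+1) : R := r ^+ k / g.

Lemma geometric_sum_gt0 : 0 < g.
Proof.
rewrite /g big_ord_recl /= expr0 ltr_wpDr // sumr_ge0 // => i _.
by rewrite exprn_ge0 // ltW.
Qed.
Let g0 := geometric_sum_gt0.

Lemma tilted_gt0 k : 0 < tilted k.
Proof. by rewrite divr_gt0 ?exprn_gt0. Qed.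

Lemma tilted_sum : \sum_k tilted k = 1.
Proof. by rewrite -big_distrl /= divff // gt_eqF. Qed.

Lemma tilted_mean : \sum_(k < Q.+1) k%:R * tilted k = mean.
Proof.
have := fq_critical.
rewrite (eq_bigr (fun i : 'I_Q.+1 => i%:R * r ^+ i - mean * r ^+ i)); last first.
  by move=> i _; rewrite mulrBl.
rewrite sumrB -big_distrr /= -/g => /eqP; rewrite subr_eq0 => /eqP E.
under eq_bigr => k _ do rewrite /tilted mulrA.
by rewrite -big_distrl /= E mulfK // gt_eqF.
Qed.

(** Both sides equal the second moment minus [mean ^+ 2]; on the right, r^i/g is the weight of i. *)
Lemma tilted_variance : weights_variance tilted =
  (\sum_(i < Q.+1) i%:R * (i%:R - mean) * r ^+ i) / g.
Proof.
have -> : (\sum_(i < Q.+1) i%:R * (i%:R - mean) * r ^+ i) / g =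
    \sum_(k < Q.+1) k%:R ^+ 2 * tilted k - mean ^+ 2.
  rewrite -{2}tilted_mean expr2 -{1}tilted_mean.
  rewrite big_distrl [X in _ = _ - X]big_distrl -sumrB /=.
  apply: eq_bigr => k _; rewrite tilted_mean /tilted; ring.
pose B := \sum_(k < Q.+1) k%:R ^+ 2 * tilted k; rewrite -/B.
transitivity (\sum_(j < Q.+1) (2^-1 * (j%:R ^+ 2 * tilted j)
    + - mean * (j%:R * tilted j) + B / 2 * tilted j)).
  apply: eq_bigr => j _.
  rewrite (eq_bigr (fun k : 'I_Q.+1 => tilted j * j%:R ^+ 2 / 2 * tilted k
    + - (tilted j * j%:R) * (k%:R * tilted k)
    + tilted j / 2 * (k%:R ^+ 2 * tilted k))) => [|k _]; last by field.
  by rewrite !big_split -!big_distrr /= tilted_sum tilted_mean -/B; field.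
by rewrite !big_split -!big_distrr /= tilted_sum tilted_mean -/B; field.
Qed.

(** The powers r^(-mean) cancel in f/f'', leaving r^2 over the variance. This is where the factor
    1/r of the final constant comes from. *)
Lemma sqrt_fq_ratio : (0 < Q)%N ->
  Num.sqrt (fq Q.+1 r / derive1n 2 (@fq R Q.+1) r) =
  r / Num.sqrt (weights_variance tilted).
Proof.
move=> Q0; have v0 := weights_variance_gt0 Q0 tilted_gt0.
have -> : fq Q.+1 r / derive1n 2 (@fq R Q.+1) r = r ^+ 2 * (weights_variance tilted)^-1.
  move: v0; rewrite fq_derive2 tilted_variance /fq -/g -/mean powRN.
  set V := \sum_(i < _) _; set p := r `^ mean => v0.
  have p0 : p != 0 by rewrite gt_eqF // powR_gt0.
  have gn0 : g != 0 by rewrite gt_eqF.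
  have rn0 : r != 0 by rewrite gt_eqF.
  have Vn0 : V != 0 by move: v0; case: eqP => // ->; rewrite mul0r ltxx.
  by move: V g p p0 gn0 Vn0 {v0} => V g' p *; field; apply/and4P.
rewrite sqrtrM ?sqr_ge0 // sqrtr_sqr ger0_norm ?(ltW r0) //; congr (_ * _).
by rewrite sqrtrV // ltW.
Qed.

(** * Counting low-degree exponent vectors by the tilted law *)

Hypothesis r1 : r < 1.

Lemma sum_inv_powers_le M : \sum_(m < M.+1) r ^- m <= r ^- M / (1 - r).
Proof.
have r10 : 0 < 1 - r by rewrite subr_gt0.
elim: M => [|M IH].
  by rewrite big_ord1 expr0 invr1 mul1r invf_ge1 // lerBlDr lerDl ltW.
rewrite big_ord_recr /=.
apply: (@le_trans _ _ (r ^- M / (1 - r) + r ^- M.+1)); first by rewrite lerD2r.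
rewrite le_eqVlt; apply/orP; left; apply/eqP.
rewrite exprS; have rM : r ^+ M != 0 by rewrite expf_neq0 // gt_eqF.
field; rewrite rM !gt_eqF //.
Qed.

Lemma weight_tilted n (e : {ffun 'I_n -> 'I_Q.+1}) :
  weight tilted e = r ^+ total e / g ^+ n.
Proof.
rewrite /weight /tilted big_split /= prodrXr; congr (_ * _).
by rewrite prodr_const card_ord exprVn.
Qed.

(** Every vector of total m has weight r^m/g^n, so there are g^n r^(-m) P(S_n = m) of them. The
    bound [B] is uniform in m, which leaves a geometric sum dominated by its last terms. *)
Lemma card_low_degree_le n (B : R) : 0 <= B ->
  (forall m, sum_law tilted n m <= B) ->
  #|low_degree n Q|%:R <= fq Q.+1 r ^+ n / (1 - r) * B.
Proof.
move=> B0 HB.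
pose M := (Q * n %/ 3)%N.
have lowE (e : {ffun 'I_n -> 'I_Q.+1}) : (e \in low_degree n Q) = (total e <= M)%N.
  by rewrite inE /M leq_divRL // mulnC.
have -> : #|low_degree n Q|%:R = \sum_(m < M.+1) g ^+ n * r ^- m * sum_law tilted n m.
  rewrite -sum1_card natr_sum (eq_bigl _ _ lowE).
  rewrite (partition_big (fun e => inord (total e) : 'I_M.+1) xpredT) //=.
  apply: eq_bigr => m _; rewrite /sum_law big_distrr /=.
  apply: eq_big => [e|e /andP[eM /eqP <-]].
    apply/andP/eqP => [[eM /eqP <-]|em]; first by rewrite inordK.
    by rewrite em -ltnS ltn_ord; split=> //; apply/eqP/val_inj; rewrite /= inordK.
  rewrite weight_tilted inordK //.
  by field; rewrite !expf_neq0 ?gt_eqF.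
apply: (@le_trans _ _ (\sum_(m < M.+1) g ^+ n * r ^- m * B)).
  apply: ler_sum => m _; rewrite ler_wpM2l //.
  by rewrite mulr_ge0 ?invr_ge0 ?exprn_ge0 ?(ltW g0) ?(ltW r0).
rewrite -big_distrl ler_wpM2r //= -big_distrr /=.
apply: (@le_trans _ _ (g ^+ n * (r ^- M / (1 - r)))).
  by rewrite ler_wpM2l ?sum_inv_powers_le // exprn_ge0 // ltW.
rewrite mulrA ler_wpM2r ?invr_ge0 ?subr_ge0 ?(ltW r1) //.
rewrite /fq -/g -/mean exprMn exprVn ler_wpM2l ?exprn_ge0 ?(ltW g0) //.
rewrite lef_pV2 ?posrE ?exprn_gt0 ?powR_gt0 //.
rewrite -!powR_mulrn ?(ltW r0) ?powR_ge0 // -powRrM.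
(* Since r < 1, rounding Qn/3 down to [M] only decreases r^(-M), so g^n r^(-M) <= f(r)^n. *)
apply: ger_powR; first by rewrite r0 ltW.
rewrite /mean -natr1 addrK mulrAC ler_pdivlMr // -!natrM ler_nat.
exact: leq_trunc_div.
Qed.

End critical_point.

(** * The bound on the size of A *)

Theorem theorem1p3 (R : realType) (q : nat) (hq : prime_power q)
    (r : R) (hr0 : 0 < r) (hr1 : r < 1)
    (hmin : forall x : R, 0 < x -> fq q r <= fq q x) :
  (exists eps : nat -> R,
     (eps n @[n --> \oo] --> (0 : R)) /\
     (forall (F : finFieldType) (n : nat) (a b c : F) (A : {set 'rV[F]_n}),
        #|F| = q -> (0 < n)%N -> a + b + c = 0 -> c != 0 ->
        only_trivial_solutions a b c A ->
        #|A|%:R <= 3 / ((1 - r) * r) * Num.sqrt (fq q r / derive1n 2 (@fq R q) r)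
                   * (fq q r ^+ n / Num.sqrt (2 * pi * n%:R)) * (1 + eps n)))
  /\
  (exists C : R,
     forall (F : finFieldType) (n : nat) (a b c : F) (A : {set 'rV[F]_n}),
       #|F| = q -> (0 < n)%N -> a + b + c = 0 -> c != 0 ->
       only_trivial_solutions a b c A ->
       #|A|%:R <= C * (fq q r ^+ n / Num.sqrt n%:R)).
Proof.
have [Q [Q0 qE]] : exists Q, (0 < Q)%N /\ q = Q.+1.
  have [p [k [pp k0 qE]]] := hq.
  have q1 : (1 < q)%N by rewrite qE -(exp1n k) ltn_exp2r ?prime_gt1.
  by exists q.-1; split; lia.
subst q.
(* The error depends on q and r only, as it is obtained before F, a, b, c and A are introduced. *)
have [eps [eps_cvg eps_ge0 law_le]] :=
  local_limit_upper Q0 (tilted_gt0 (Q := Q) hr0) (tilted_sum Q hr0).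
have bound (F : finFieldType) (n : nat) (a b c : F) (A : {set 'rV[F]_n}) :
    #|F| = Q.+1 -> (0 < n)%N -> a + b + c = 0 -> c != 0 ->
    only_trivial_solutions a b c A ->
    #|A|%:R <= 3 / ((1 - r) * r) * Num.sqrt (fq Q.+1 r / derive1n 2 (@fq R Q.+1) r)
                   * (fq Q.+1 r ^+ n / Num.sqrt (2 * pi * n%:R)) * (1 + eps n).
  move=> cardF n0 abc _ trivA.
  have leA := card_le_low_degree cardF abc trivA.
  have B0 : 0 <= (1 + eps n) /
      (Num.sqrt (weights_variance (tilted r (Q := Q))) * Num.sqrt (2 * pi * n%:R)).
    by rewrite divr_ge0 ?addr_ge0 ?mulr_ge0 ?sqrtr_ge0.
  have := card_low_degree_le hr0 hr1 B0 (fun m => law_le n m n0).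
  rewrite (sqrt_fq_ratio hr0 hmin Q0) => leN.
  apply: (@le_trans _ _ (3 * #|low_degree n Q|%:R)).
    by rewrite -natrM ler_nat.
  apply: le_trans (ler_wpM2l _ leN) _ => //.
  rewrite le_eqVlt; apply/orP; left; apply/eqP.
  have rn0 : r != 0 by rewrite gt_eqF.
  have r1n0 : 1 - r != 0 by rewrite gt_eqF // subr_gt0.
  rewrite !invfM; move: (Num.sqrt _)^-1 (Num.sqrt _)^-1 => x y.
  by field; apply/andP.
split; first by exists eps.
(* A convergent error is bounded for all n, so one constant C serves every n > 0. The bound is
   stated for reals beyond [M], hence the use of M + 1. *)
have [M [_ epsM]] := cvg_seq_bounded (cvgP _ eps_cvg).
have {}epsM n : eps n <= M + 1.
  by apply: le_trans (ler_norm _) _; apply: (epsM (M + 1)); rewrite ?ltrDl.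
set K := 3 / ((1 - r) * r) * Num.sqrt (fq Q.+1 r / derive1n 2 (@fq R Q.+1) r) in bound.
exists (K / Num.sqrt (2 * pi) * (1 + (M + 1))) => F n a b c A cardF n0 abc c0 trivA.
apply: le_trans (bound F n a b c A cardF n0 abc c0 trivA) _.
have f0 : 0 <= fq Q.+1 r.
  by rewrite divr_ge0 ?powR_ge0 // sumr_ge0 // => i _; rewrite exprn_ge0 // ltW.
have K0 : 0 <= K.
  by rewrite mulr_ge0 ?sqrtr_ge0 // divr_ge0 // mulr_ge0 ?subr_ge0 // ltW.
rewrite sqrtrM ?mulr_ge0 ?pi_ge0 //.
apply: (@le_trans _ _ (K * (fq Q.+1 r ^+ n / (Num.sqrt (2 * pi) * Num.sqrt n%:R))
  * (1 + (M + 1)))).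
  apply: ler_wpM2l; last by rewrite lerD2l.
  apply: mulr_ge0 => //; apply: divr_ge0; first exact: exprn_ge0.
  by apply: mulr_ge0; exact: sqrtr_ge0.
rewrite invfM; move: (Num.sqrt _)^-1 (Num.sqrt _)^-1 => x y.
by rewrite le_eqVlt; apply/orP; left; apply/eqP; ring.
Qed.
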